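(* Let $P$ and $Q$ be two TRAPs and $\phi=(\phi(k,l))_{k,l}:P\to Q$ a morphism of TRAPs. Then $\phi$ is a morphism for the vertical concatenations of $P$ and $Q$: for all $k,l,m\in\mathbb N_0$, $p_1\in P(k,l)$ and $p_2\in P(l,m)$, $\phi(p_2\circ p_1)=\phi(p_2)\circ\phi(p_1)$.
   Context: Notation: $\mathbb{N}_0=\{0,1,2,\dots\}$, $[k]=\{1,\dots,k\}$, $\mathfrak S_k$ is the symmetric group on $[k]$. TRAP. A TRAP is a family $P=(P(k,l))_{k,l\ge 0}$ of sets with: (1) for all $k,l\in\mathbb N_0$, a left action of $\mathfrak S_l$ and a right action of $\mathfrak S_k$ on $P(k,l)$ which commute. (2) Maps $*:P(k,l)\times P(k',l')\to P(k+k',l+l')$ (horizontal concatenation) such that: $*$ is associative; there is $I_0\in P(0,0)$ with $I_0*p=p*I_0=p$; $(\sigma\cdot p\cdot\tau)*(\sigma'\cdot p'\cdot\tau')=(\sigma\otimes\sigma')\cdot(p*p')\cdot(\tau\otimes\tau')$, where for $\alpha\in\mathfrak S_m,\beta\in\mathfrak S_n$, $(\alpha\otimes\beta)(i)=\alpha(i)$ if $i\le m$ and $\beta(i-m)+m$ if $i>m$; and $c_{l,l'}\cdot(p*p')=(p'*p)\cdot c_{k,k'}$ for $p\in P(k,l)$, $p'\in P(k',l')$, where $c_{m,n}\in\mathfrak S_{m+n}$, $c_{m,n}(i)=i+n$ if $i\le m$ and $i-m$ if $i>m$. (3) For $k,l\ge1$, $i\in[k]$, $j\in[l]$, maps $t_{i,j}:P(k,l)\to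 P(k-1,l-1)$ (partial trace maps) such that: (a) for $k,l\ge2$, $i\in[k]$, $j\in[l]$, $i'\in[k-1]$, $j'\in[l-1]$: $t_{i',j'}\circ t_{i,j}$ equals $t_{i-1,j-1}\circ t_{i',j'}$ if $i'<i,j'<j$; $t_{i,j-1}\circ t_{i'+1,j'}$ if $i'\ge i,j'<j$; $t_{i-1,j}\circ t_{i',j'+1}$ if $i'<i,j'\ge j$; $t_{i,j}\circ t_{i'+1,j'+1}$ if $i'\ge i,j'\ge j$. (b) $t_{i,j}(\sigma\cdot p\cdot\tau)=\sigma_j\cdot t_{\tau(i),\sigma^{-1}(j)}(p)\cdot\tau_{\tau(i)}$, where for $\alpha\in\mathfrak S_n$ and $q\in[n]$, $\alpha_q\in\mathfrak S_{n-1}$ is the permutation whose word is obtained from the word $\alpha(1)\dots\alpha(n)$ by deleting the letter $q$ and subtracting $1$ from all letters $>q$. (c) for $p\in P(k,l)$, $p'\in P(k',l')$ ($k,l,k',l'\ge0$), $i\in[k+k']$, $j\in[l+l']$: $t_{i,j}(p*p')=t_{i,j}(p)*p'$ if $i\le k,j\le l$, and $t_{i,j}(p*p')=p*t_{i-k,j-l}(p')$ if $i>k,j>l$. A morphism of TRAPs $\phi:P\to Q$ is a family of maps $\phi(k,l):P(k,l)\to Q(k,l)$ (all written $\phi$) commuting with the symmetric group actions, with $\phi(I_0)=I_0$, $\phi(p*q)=\phi(p)*\phi(q)$ and $\phi\circ t_{i,j}=t_{i,j}\circ\phi$. The vertical concatenation in a TRAP is defined for $p\in P(k,l)$, $q\in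 P(l,m)$ by $q\circ p=t_{k+1,1}\circ\cdots\circ t_{k+l-1,l-1}\circ t_{k+l,l}(p*q)\in P(k,m)$. *)

(* Defs.v *)
From mathcomp Require Import all_boot all_fingroup.
Set Implicit Arguments.
Unset Strict Implicit.
Unset Printing Implicit Defensive.

(* The interval [n] = {1, ..., n} is encoded by 'I_n, so every index is shifted
   down by one.  The MathComp product (s * t)%g is t \o s, the opposite of the
   composition of permutations s \o t used for the left and right actions
   below. *)

Definition tens_fun m n (a : 'S_m) (b : 'S_n) (i : 'I_(m + n)) : 'I_(m + n) :=
  match split i with
  | inl j => lshift n (a j)
  | inr j => rshift m (b j)
  end.

Lemma tens_fun_inj m n (a : 'S_m) (b : 'S_n) : injective (tens_fun a b).
Proof.
have tensK (c : 'S_m) (d : 'S_n) :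
    cancel (tens_fun c d) (tens_fun c^-1%g d^-1%g).
  move=> i; rewrite /tens_fun; case: (split_ordP i) => j ->.
    by rewrite (unsplitK (inl _)) permK.
  by rewrite (unsplitK (inr _)) permK.
exact: can_inj (tensK a b).
Qed.

Definition perm_tens m n (a : 'S_m) (b : 'S_n) : 'S_(m + n) :=
  perm (@tens_fun_inj m n a b).

(* i |-> i + n on the first m indices, i |-> i - m on the last n. *)
Definition block_fun m n (i : 'I_(m + n)) : 'I_(m + n) :=
  match split i with
  | inl j => cast_ord (addnC n m) (rshift n j)
  | inr j => cast_ord (addnC n m) (lshift m j)
  end.

Lemma block_fun_inj m n : injective (@block_fun m n).
Proof.
move=> i i'; rewrite /block_fun.
case: (split_ordP i) => j ->; case: (split_ordP i') => j' -> /cast_ord_inj.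
- by move/rshift_inj ->.
- by move/eqP; rewrite eq_rlshift.
- by move/eqP; rewrite eq_lrshift.
- by move/lshift_inj ->.
Qed.

Definition block_perm m n : 'S_(m + n) := perm (@block_fun_inj m n).

(* The letter q of the word of a sits at position a^-1 q, which [lift] skips;
   [unlift q] subtracts 1 from the letters greater than q, and is never None
   here. *)
Definition del_fun n (a : 'S_n.+1) (q : 'I_n.+1) (i : 'I_n) : 'I_n :=
  odflt i (unlift q (a (lift ((a^-1)%g q) i))).

Lemma lift_del_fun n (a : 'S_n.+1) (q : 'I_n.+1) (i : 'I_n) :
  lift q (del_fun a q i) = a (lift ((a^-1)%g q) i).
Proof.
rewrite /del_fun; case: unliftP => [j -> //|] /= e.
by have := neq_lift ((a^-1)%g q) i; rewrite -{1}e permK eqxx.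
Qed.

Lemma del_fun_inj n (a : 'S_n.+1) (q : 'I_n.+1) : injective (del_fun a q).
Proof.
move=> i i' /(congr1 (lift q)); rewrite !lift_del_fun.
by move/perm_inj/lift_inj.
Qed.

Definition perm_del n (a : 'S_n.+1) (q : 'I_n.+1) : 'S_n :=
  perm (@del_fun_inj n a q).

Lemma perm_del_word n (a : 'S_n.+1) (q : 'I_n.+1) :
  [seq val (perm_del a q i) | i <- enum 'I_n] =
  [seq unbump q x | x <- [seq val (a i) | i <- enum 'I_n.+1] & x != val q].
Proof.
set h := (a^-1)%g q.
have skip : [seq i <- enum 'I_n.+1 | a i != q] = map (lift h) (enum 'I_n).
  have sorted_enum k : sorted (relpre val ltn) (enum 'I_k).
    by rewrite -sorted_map val_enum_ord iota_ltn_sorted.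
  apply: (@irr_sorted_eq _ (relpre val ltn)).
  - by move=> x y z /=; apply: ltn_trans.
  - by move=> x /=; rewrite ltnn.
  - by apply: sorted_filter (sorted_enum _) => x y z /=; apply: ltn_trans.
  - rewrite sorted_map; apply: sub_sorted (sorted_enum n) => x y /=.
    by rewrite !ltnNge leq_bump2.
  move=> i; rewrite mem_filter mem_enum andbT.
  have -> : (a i != q) = (h != i).
    by rewrite -{1}(permKV a q) (inj_eq perm_inj) eq_sym.
  apply/idP/mapP => [hi | [j _ ->]]; last exact: neq_lift.
  by have [j -> _] := unlift_some hi; exists j; rewrite ?mem_enum.
rewrite filter_map (eq_filter (a2 := fun i => a i != q)) // skip -!map_comp.
apply: eq_map => i /=.
by rewrite permE -/h -lift_del_fun /= bumpK.
Qed.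

Definition cast_kl (P : nat -> nat -> Type) k k' l l'
    (ek : k = k') (el : l = l') (p : P k l) : P k' l' :=
  let: erefl in _ = k' := ek return P k' l' in
  let: erefl in _ = l' := el return P k l' in p.

Record TRAP := Trap {
  trap_set :> nat -> nat -> Type;

  lact : forall k l, 'S_l -> trap_set k l -> trap_set k l;
  ract : forall k l, trap_set k l -> 'S_k -> trap_set k l;
  lact1 : forall k l (p : trap_set k l), lact 1%g p = p;
  lactM : forall k l (s s' : 'S_l) (p : trap_set k l),
    lact s (lact s' p) = lact (s' * s)%g p;
  ract1 : forall k l (p : trap_set k l), ract p 1%g = p;
  ractM : forall k l (p : trap_set k l) (t t' : 'S_k),
    ract (ract p t) t' = ract p (t' * t)%g;
  lractA : forall k l (s : 'S_l) (p : trap_set k l) (t : 'S_k),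
    ract (lact s p) t = lact s (ract p t);

  hcat : forall k l k' l',
    trap_set k l -> trap_set k' l' -> trap_set (k + k') (l + l');
  hunit : trap_set 0 0;
  hcatA : forall k l k' l' k'' l''
      (p : trap_set k l) (p' : trap_set k' l') (p'' : trap_set k'' l''),
    cast_kl (addnA k k' k'') (addnA l l' l'') (hcat p (hcat p' p'')) =
    hcat (hcat p p') p'';
  hcat1p : forall k l (p : trap_set k l), hcat hunit p = p;
  hcatp1 : forall k l (p : trap_set k l),
    cast_kl (addn0 k) (addn0 l) (hcat p hunit) = p;
  hcat_act : forall k l k' l' (p : trap_set k l) (p' : trap_set k' l')
      (s : 'S_l) (t : 'S_k) (s' : 'S_l') (t' : 'S_k'),
    hcat (ract (lact s p) t) (ract (lact s' p') t') =
    ract (lact (perm_tens s s') (hcat p p')) (perm_tens t t');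
  hcatC : forall k l k' l' (p : trap_set k l) (p' : trap_set k' l'),
    lact (block_perm l l') (hcat p p') =
    ract (cast_kl (addnC k' k) (addnC l' l) (hcat p' p)) (block_perm k k');

  ptr : forall k l, 'I_k.+1 -> 'I_l.+1 -> trap_set k.+1 l.+1 -> trap_set k l;
  (* In the four cases below [inord] only coerces an index to the required
     ordinal type: its argument is always in range. *)
  ptr_ptr_ltlt : forall k l (p : trap_set k.+2 l.+2)
      (i : 'I_k.+2) (j : 'I_l.+2) (i' : 'I_k.+1) (j' : 'I_l.+1),
    i' < i -> j' < j ->
    ptr i' j' (ptr i j p) =
    ptr (inord i.-1) (inord j.-1) (ptr (inord i') (inord j') p);
  ptr_ptr_gelt : forall k l (p : trap_set k.+2 l.+2)
      (i : 'I_k.+2) (j : 'I_l.+2) (i' : 'I_k.+1) (j' : 'I_l.+1),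
    i <= i' -> j' < j ->
    ptr i' j' (ptr i j p) =
    ptr (inord i) (inord j.-1) (ptr (inord i'.+1) (inord j') p);
  ptr_ptr_ltge : forall k l (p : trap_set k.+2 l.+2)
      (i : 'I_k.+2) (j : 'I_l.+2) (i' : 'I_k.+1) (j' : 'I_l.+1),
    i' < i -> j <= j' ->
    ptr i' j' (ptr i j p) =
    ptr (inord i.-1) (inord j) (ptr (inord i') (inord j'.+1) p);
  ptr_ptr_gege : forall k l (p : trap_set k.+2 l.+2)
      (i : 'I_k.+2) (j : 'I_l.+2) (i' : 'I_k.+1) (j' : 'I_l.+1),
    i <= i' -> j <= j' ->
    ptr i' j' (ptr i j p) =
    ptr (inord i) (inord j) (ptr (inord i'.+1) (inord j'.+1) p);
  ptr_act : forall k l (s : 'S_l.+1) (p : trap_set k.+1 l.+1) (t : 'S_k.+1)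
      (i : 'I_k.+1) (j : 'I_l.+1),
    ptr i j (ract (lact s p) t) =
    ract (lact (perm_del s j) (ptr (t i) ((s^-1)%g j) p)) (perm_del t (t i));
  ptr_hcatl : forall k l k' l' (p : trap_set k.+1 l.+1) (p' : trap_set k' l')
      (i : 'I_k.+1) (j : 'I_l.+1),
    @ptr (k + k') (l + l') (lshift k' i) (lshift l' j) (hcat p p') =
    hcat (ptr i j p) p';
  ptr_hcatr : forall k l k' l' (p : trap_set k l) (p' : trap_set k'.+1 l'.+1)
      (i : 'I_k'.+1) (j : 'I_l'.+1),
    ptr (cast_ord (addnS k k') (rshift k i)) (cast_ord (addnS l l') (rshift l j))
        (cast_kl (addnS k k') (addnS l l') (hcat p p')) =
    hcat p (ptr i j p')
}.

(* t_{k+1,1} o ... o t_{k+l,l}, the rightmost trace being applied first. *)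
Fixpoint iter_ptr (P : TRAP) k l m : P (k + l) (l + m) -> P k m :=
  match l return P (k + l) (l + m) -> P k m with
  | 0 => fun r => cast_kl (addn0 k) erefl r
  | l'.+1 => fun r =>
      iter_ptr (@ptr P (k + l') (l' + m) ord_max (lshift m (@ord_max l'))
                  (cast_kl (addnS k l') erefl r))
  end.

Definition vcat (P : TRAP) k l m (q : P l m) (p : P k l) : P k m :=
  iter_ptr (hcat p q).

Record trap_morphism (P Q : TRAP) := TrapMorphism {
  tm_fun :> forall k l, P k l -> Q k l;
  tm_lact : forall k l (s : 'S_l) (p : P k l),
    tm_fun (lact s p) = lact s (tm_fun p);
  tm_ract : forall k l (p : P k l) (t : 'S_k),
    tm_fun (ract p t) = ract (tm_fun p) t;
  tm_hunit : tm_fun (hunit P) = hunit Q;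
  tm_hcat : forall k l k' l' (p : P k l) (q : P k' l'),
    tm_fun (hcat p q) = hcat (tm_fun p) (tm_fun q);
  tm_ptr : forall k l (i : 'I_k.+1) (j : 'I_l.+1) (p : P k.+1 l.+1),
    tm_fun (ptr i j p) = ptr i j (tm_fun p)
}.

(* Main.v *)
Require Import Defs.
From mathcomp Require Import all_boot all_fingroup.

(** The vertical concatenation is a horizontal concatenation followed by
    partial traces, and a morphism commutes with each of these operations.
    The transports between [P (k + l.+1) _] and [P (k + l).+1 _] only rename
    the component of the family being considered, so they commute with any
    family of maps; an induction on the number of traces
    ([tm_iter_ptr]) then gives the result. *)

Lemma tm_cast_kl (P Q : nat -> nat -> Type) (f : forall k l, P k l -> Q k l)
    k k' l l' (ek : k = k') (el : l = l') (p : P k l) :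
  f k' l' (cast_kl ek el p) = cast_kl ek el (f k l p).
Proof. by case: k' / ek; case: l' / el. Qed.

(** The element [r] has to vary in the induction: the trace taken first
    replaces it by an element of another component. *)
Lemma tm_iter_ptr (P Q : TRAP) (phi : trap_morphism P Q) k l m
    (r : P (k + l) (l + m)) :
  phi k m (iter_ptr r) = iter_ptr (phi (k + l) (l + m) r).
Proof.
elim: l r => [|l IHl] r /=; first exact: tm_cast_kl.
by rewrite IHl tm_ptr (tm_cast_kl _ _ phi).
Qed.

Theorem proposition4p1p2 (P Q : TRAP) (phi : trap_morphism P Q)
    (k l m : nat) (p1 : P k l) (p2 : P l m) :
  phi k m (vcat p2 p1) = vcat (phi l m p2) (phi k l p1).
Proof. by rewrite /vcat tm_iter_ptr tm_hcat. Qed.
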